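(* Let $\mathscr{H}$ be a Hadamard space with metric $d$ and let $\{x_n\}$ be a bounded sequence in $\mathscr{H}$ whose set of terms $\{x_n : n=1,2,3,\ldots\}$ is relatively compact. Then $\{x_n\}$ is almost periodic if and only if for each $x\in\mathscr{H}$ the real sequence $\{d(x_n,x)\}$ is almost periodic.
   Context: A Hadamard space is a complete $CAT(0)$ space. A sequence $\{x_n\}$ in a metric space $(X,d)$ is called almost periodic if for each $\epsilon>0$ there are natural numbers $L=L(\epsilon)$ and $N=N(\epsilon)$ such that any interval $(k,k+L)$ with $k\geq 0$ contains at least one integer $p$ satisfying $d(x_{n+p},x_n)<\epsilon$ for all $n\geq N$. For real sequences this is applied in $\mathbb{R}$ with its usual metric. *)

(* Defs.v *)
From HB Require Import structures.
From mathcomp Require Import all_boot all_order all_algebra.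
From mathcomp Require Import all_classical all_reals all_analysis.

Set Implicit Arguments.
Unset Strict Implicit.
Unset Printing Implicit Defensive.

Import Order.TTheory GRing.Theory Num.Theory.
Import numFieldNormedType.Exports.

Local Open Scope classical_set_scope.
Local Open Scope ring_scope.

(* The library norm on row vectors is the sup norm, so the
   distance of the Euclidean plane E^2 is written out here. *)
Definition eucl_dist (R : realType) (u v : 'rV[R]_2) : R :=
  Num.sqrt (\sum_(i < 2) (u 0 i - v 0 i) ^+ 2).

Definition eucl_segment (R : realType) (u v : 'rV[R]_2) : set 'rV[R]_2 :=
  [set (1 - t) *: u + t *: v | t in `[0, 1]].

(* A geodesic path is a map [0, d(x, y)] -> X; it is encoded as a function on
   all of R whose values outside [0, d(x, y)] are irrelevant. *)
Definition is_geodesic (R : realType) (X : metricType R)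
    (c : R -> X) (x y : X) : Prop :=
  [/\ c 0 = x, c (mdist x y) = y &
      forall s t : R, s \in `[0, mdist x y] -> t \in `[0, mdist x y] ->
        mdist (c s) (c t) = `|s - t|].

Definition geodesic_space (R : realType) (X : metricType R) : Prop :=
  forall x y : X, exists c : R -> X, is_geodesic c x y.

(* Side i of a triangle joins vertex i to vertex i + 1 mod 3 (ordS). *)
Definition geodesic_triangle (R : realType) (X : metricType R)
    (v : 'I_3 -> X) (c : 'I_3 -> R -> X) : Prop :=
  forall i, is_geodesic (c i) (v i) (v (ordS i)).

Definition comparison_triangle (R : realType) (X : metricType R)
    (v : 'I_3 -> X) (w : 'I_3 -> 'rV[R]_2) : Prop :=
  forall i j, eucl_dist (w i) (w j) = mdist (v i) (v j).

(* p' is the comparison point, on side i of the Euclidean triangle w, of the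
   point at distance s from vertex i on side i of the geodesic triangle. *)
Definition comparison_point (R : realType)
    (w : 'I_3 -> 'rV[R]_2) (i : 'I_3) (s : R) (p' : 'rV[R]_2) : Prop :=
  eucl_segment (w i) (w (ordS i)) p' /\ eucl_dist (w i) p' = s.

Definition CAT0_inequality (R : realType) (X : metricType R)
    (v : 'I_3 -> X) (c : 'I_3 -> R -> X) (w : 'I_3 -> 'rV[R]_2) : Prop :=
  forall (i j : 'I_3) (s t : R) (p' q' : 'rV[R]_2),
    s \in `[0, mdist (v i) (v (ordS i))] ->
    t \in `[0, mdist (v j) (v (ordS j))] ->
    comparison_point w i s p' -> comparison_point w j t q' ->
    mdist (c i s) (c j t) <= eucl_dist p' q'.

(* Comparison triangles exist and are unique up to isometry of the plane, so
   quantifying over all of them is the same as choosing one. *)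
Definition CAT0_space (R : realType) (X : metricType R) : Prop :=
  geodesic_space X /\
  forall (v : 'I_3 -> X) (c : 'I_3 -> R -> X) (w : 'I_3 -> 'rV[R]_2),
    geodesic_triangle v c -> comparison_triangle v w -> CAT0_inequality v c w.

Definition complete_metric (R : realType) (X : metricType R) : Prop :=
  forall u : nat -> X, cauchy (u @ \oo) -> exists l : X, u @ \oo --> l.

Definition hadamard_space (R : realType) (X : metricType R) : Prop :=
  complete_metric X /\ CAT0_space X.

Definition metric_bounded (R : realType) (X : metricType R) (A : set X) : Prop :=
  exists (a : X) (M : R), forall z, A z -> mdist a z <= M.

(* Sequences are indexed from 0: the terms x_1, x_2, ... of the usual notation
   are x 0, x 1, ... *)
Definition almost_periodic (R : realType) (X : metricType R)
    (x : nat -> X) : Prop :=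
  forall e : R, 0 < e -> exists L N : nat, forall k : nat,
    exists p : nat, [/\ (k < p)%N, (p < k + L)%N &
      forall n : nat, (N <= n)%N -> mdist (x (n + p)%N) (x n) < e].

(* Main.v *)
Require Import Defs.
From mathcomp Require Import all_boot all_order all_algebra.
From mathcomp Require Import all_classical all_reals all_analysis.
From mathcomp Require Import zify lra.

Import Order.TTheory GRing.Theory Num.Theory.
Import numFieldNormedType.Exports.

Local Open Scope classical_set_scope.
Local Open Scope ring_scope.

(** The triangle inequality makes [mdist ^~ y] nonexpansive, so an almost period
    of [x] is an almost period, for the same [e] and [N], of each sequence of
    distances to a point; this gives the direct implication.

    For the converse, relative compactness gives a finite [e]-net [s] of the
    terms. If [p] is an [e]-almost period of the distances to all points of [s]
    simultaneously, then for large [n] a point [y] of [s] with [d (x n) y < e]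
    satisfies [d (x (n + p)) y < 2 e], hence [d (x (n + p)) (x n) < 3 e]. So
    everything rests on finitely many almost periodic sequences having a
    relatively dense set of common almost periods
    ([common_almost_periods]). This is a pigeonhole argument: record, for each
    [k], the offsets from [k] of an almost period in [(k, k + L)] of each of the
    sequences. Only finitely many offset vectors occur, and if [j < k] have the
    same one, then [k - j] is the difference of two almost periods of each
    sequence, hence a common almost period. *)

Lemma almost_periodic_nonexpansive (R : realType) (X Y : metricType R)
    (f : X -> Y) (u : nat -> X) :
  (forall a b, mdist (f a) (f b) <= mdist a b) ->
  almost_periodic u -> almost_periodic (f \o u).
Proof.
move=> f_nonexp u_ap e e0; have [L [N LN]] := u_ap e e0.
exists L, N => k; have [p [kp pk pP]] := LN k.
by exists p; split=> // n Nn; apply: le_lt_trans (f_nonexp _ _) (pP n Nn).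
Qed.

Lemma ler_dist_mdist (R : realType) (X : metricType R) (a b y : X) :
  `|mdist a y - mdist b y| <= mdist a b.
Proof.
have aby := metric_triangle a b y; have bay := metric_triangle b a y.
by rewrite (metric_sym b a) in bay; rewrite ler_norml; lra.
Qed.

(** Pigeonhole with a uniform bound: pick one occurrence of each colour that
    occurs at all, and let [K] be the latest of these finitely many indices. *)
Lemma finite_colours_early (C : finType) (c : nat -> C) :
  exists K : nat, forall k, exists2 j, (j <= K)%N & c j = c k.
Proof.
have /choice [occ occP] (a : C) :
    exists j0, forall k, c k = a -> c j0 = a.
  have [[j <-]|no_a] := pselect (exists j, c j = a); first by exists j.
  by exists 0%N => k cka; case: no_a; exists k.
exists (\max_a occ a) => k; exists (occ (c k)); first exact: leq_bigmax.
exact: occP.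
Qed.

(** For given [k], the pigeonhole is applied at [k + K + 1]: an index [j <= K]
    with the same offsets gives the common almost period [k + K + 1 - j], which
    lies in [(k, k + K + 2)]. Subtracting two almost periods doubles the error,
    whence the [e / 2]. *)
Lemma common_almost_periods (R : realType) (X : metricType R) (I : finType)
    (u : I -> nat -> X) :
  (forall i, almost_periodic (u i)) ->
  forall e : R, 0 < e -> exists L N : nat, forall k : nat,
    exists p : nat, [/\ (k < p)%N, (p < k + L)%N &
      forall i n, (N <= n)%N -> mdist (u i (n + p)%N) (u i n) < e].
Proof.
move=> u_ap e e0; have e20 : 0 < e / 2 by lra.
have /choice [LN LNP] i : exists LN : nat * nat, forall k, exists p : nat,
    [/\ (k < p)%N, (p < k + LN.1)%N & forall n, (LN.2 <= n)%N ->
      mdist (u i (n + p)%N) (u i n) < e / 2].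
  by have [L [N H]] := u_ap i _ e20; exists (L, N).
pose L := (\max_i (LN i).1)%N; pose N := (\max_i (LN i).2)%N.
have /choice [off offP] k : exists off : {ffun I -> 'I_L.+1},
    forall i n, (N <= n)%N -> mdist (u i (n + (k + off i))%N) (u i n) < e / 2.
  have /choice [p pP] i := LNP i k.
  exists [ffun i => inord (p i - k)%N] => i n Nn.
  have [kp pk pn] := pP i.
  have LiL : ((LN i).1 <= L)%N by apply: (leq_bigmax i).
  have NiN : ((LN i).2 <= N)%N by apply: (leq_bigmax i).
  rewrite ffunE inordK; last by lia.
  by rewrite subnKC ?(ltnW kp)//; apply: pn; apply: leq_trans Nn.
have [K KP] := finite_colours_early _ off.
exists K.+2, N => k; have [j jK offjk] := KP (k + K.+1)%N.
exists (k + K.+1 - j)%N; split; [lia|lia|move=> i n Nn].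
set p := (k + K.+1 - j)%N.
set m := (k + K.+1)%N in offjk p *.
have far := offP m i n Nn.
have near_j := offP j i (n + p)%N (leq_trans Nn (leq_addr _ _)).
(* Both almost periods lead to the same term of [u i]. *)
have same : (n + p + (j + off j i) = n + (m + off m i))%N.
  by rewrite offjk /p /m; lia.
rewrite same metric_sym in near_j.
have := metric_triangle (u i (n + p)%N) (u i (n + (m + off m i))%N) (u i n).
by lra.
Qed.

(** Compactness of the closure is used through the filter of eventually large
    finite lists of points, which also covers spaces without a distinguished
    point. *)
Lemma precompact_finite_net (R : realType) (X : metricType R) (A : set X) :
  precompact A -> forall e : R, 0 < e ->
  exists s : seq X, forall z, A z -> exists2 y, y \in s & mdist z y < e.
Proof.
rewrite precompactE => /compact_near_coveringP cA e e0.
pose F : set_system (seq X) :=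
  [set P | exists s0 : seq X, forall s : seq X, {subset s0 <= s} -> P s].
have FF : Filter F.
  split; first by exists [::].
  - move=> P Q [s sP] [t tQ]; exists (s ++ t) => r str; split.
    + by apply: sP => a sa; apply: str; rewrite mem_cat sa.
    + by apply: tQ => a ta; apply: str; rewrite mem_cat ta orbT.
  - by move=> P Q PQ [s sP]; exists s => t /sP /PQ.
have [|s sP] := cA _ F (fun s z => exists2 y, y \in s & mdist z y < e) FF.
  move=> a _; exists (ball a e, [set s : seq X | a \in s]).
    split; first exact: nbhsx_ballx.
    by exists [:: a] => s; apply; rewrite mem_head.
  move=> [z s] /= [az als]; exists a => //.
  by rewrite metric_sym; move: az; rewrite ballEmdist.
by exists s => z Az; apply: (sP s) => //; exact: subset_closure.
Qed.

Theorem proposition3p3 (R : realType) (H : metricType R) (x : nat -> H)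
    (hadamardH : hadamard_space H)
    (x_bounded : metric_bounded (range x))
    (x_relcompact : precompact (range x)) :
  almost_periodic x <->
  forall y : H, almost_periodic (fun n => mdist (x n) y : R^o).
Proof.
split=> [x_ap y|dist_ap].
  apply: (@almost_periodic_nonexpansive R H R^o (fun z => mdist z y)) x_ap.
  by move=> a b; rewrite metric_sym; exact: ler_dist_mdist.
move=> e e0; have e30 : 0 < e / 3 by lra.
have [s sP] := @precompact_finite_net R H _ x_relcompact _ e30.
have [L [N LN]] := @common_almost_periods R R^o (seq_sub s)
  (fun y n => mdist (x n) (val y)) (fun y => dist_ap (val y)) _ e30.
exists L, N => k; have [p [kp pk pP]] := LN k; exists p; split=> // n Nn.
have [|y ys xny] := sP (x n); first by exists n.
have := pP (SeqSub ys) n Nn.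
rewrite metric_sym => /(le_lt_trans (ler_norm _)) /= xnpy.
have := metric_triangle (x (n + p)%N) y (x n).
by rewrite (metric_sym y); lra.
Qed.
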